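(* Let $D\ge 0$ be an integer. Every subset $F\subseteq\mathbb{Z}^3$ of $d_{\mathrm a}$-diameter at most $D$ satisfies $$|F|\le M_3(D):=\binom{D+3}{3}+(D+1)\left\lfloor\frac{D^2}{4}\right\rfloor .$$ Equality is attained by the set $S_{3,D}$ (which has $d_{\mathrm a}$-diameter $D$). Equivalently, the same statement holds in $(A_3,d)$: every subset of $A_3$ of $d$-diameter at most $D$ has at most $M_3(D)$ elements, and this bound is attained.
   Context: For $u\in\mathbb{R}$ put $u^+=\max\{u,0\}$. The asymmetric Manhattan metric on $\mathbb{Z}^n$ is $$d_{\mathrm a}(x,y)=\max\Big\{\sum_{i=1}^n(x_i-y_i)^+,\ \sum_{i=1}^n(y_i-x_i)^+\Big\}.$$ A set has $d_{\mathrm a}$-diameter at most $D$ if any two of its points are at $d_{\mathrm a}$-distance at most $D$. The root lattice is $A_n=\{z=(z_0,\dots,z_n)\in\mathbb{Z}^{n+1}:\sum_{i=0}^n z_i=0\}$ with metric $d(z,w)=\frac12\sum_{i=0}^n|z_i-w_i|$; the map $(x_1,\dots,x_n)\mapsto(x_1,\dots,x_n,-\sum_i x_i)$ is an isometry from $(\mathbb{Z}^n,d_{\mathrm a})$ onto $(A_n,d)$. For nonnegative integers $P,Q$, $$S_n(P,Q)=\Big\{x\in\mathbb{Z}^n:\ \sum_{i=1}^n x_i^+\le P,\ \sum_{i=1}^n(-x_i)^+\le Q\Big\},$$ and $S_{n,D}=S_n(\lceil D/2\rceil,\lfloor D/2\rfloor)$. *)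

(* Defs.v *)
From mathcomp Require Import all_boot all_order all_algebra.
From mathcomp Require Import boolp classical_sets functions cardinality.

Set Implicit Arguments.
Unset Strict Implicit.
Unset Printing Implicit Defensive.

Import Order.TTheory GRing.Theory Num.Theory.

Local Open Scope classical_set_scope.
Local Open Scope ring_scope.

Definition pos_part (u : int) : int := Num.max u 0.

Definition dist_a (n : nat) (x y : 'rV[int]_n) : int :=
  Num.max (\sum_(i < n) pos_part (x 0 i - y 0 i))
          (\sum_(i < n) pos_part (y 0 i - x 0 i)).

Definition root_lattice (n : nat) : set 'rV[int]_n.+1 :=
  [set z : 'rV[int]_n.+1 | \sum_(i < n.+1) z 0 i = 0].
Arguments root_lattice : clear implicits.

(* Rational-valued, since the sum need not be even off the root lattice. *)
Definition dist_A (n : nat) (z w : 'rV[int]_n.+1) : rat :=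
  2%:R^-1 * (\sum_(i < n.+1) `|z 0 i - w 0 i|)%:~R.

Definition diam_le (T : Type) (R : numDomainType) (d : T -> T -> R)
    (F : set T) (D : nat) : Prop :=
  forall x y, F x -> F y -> d x y <= D%:R.

(* On a bounded nonempty set the integer-valued dist_a attains its supremum,
   so the diameter is a maximum. *)
Definition has_diam (T : Type) (R : numDomainType) (d : T -> T -> R)
    (F : set T) (D : nat) : Prop :=
  diam_le d F D /\ exists x y, [/\ F x, F y & d x y = D%:R].

Definition S_PQ (n P Q : nat) : set 'rV[int]_n :=
  [set x : 'rV[int]_n | \sum_(i < n) pos_part (x 0 i) <= P%:Z /\
                       \sum_(i < n) pos_part (- x 0 i) <= Q%:Z].
Arguments S_PQ : clear implicits.

(* uphalf D and D./2 are the ceiling and the floor of D / 2. *)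
Definition S_D (n D : nat) : set 'rV[int]_n := S_PQ n (uphalf D) D./2.
Arguments S_D : clear implicits.

Definition M3 (D : nat) : nat := ('C(D + 3, 3) + (D + 1) * (D ^ 2 %/ 4))%N.

(* Main.v *)
(* In the coordinates u = (x2 + x3, x1 + x3, x1 + x2) the space (Z^3, d_a)
   becomes the sublattice of Z^3 of points with even coordinate sum, and
   d_a(x, y) <= D means |u_i - v_i| <= D for all i and
   sum_i |u_i - v_i| <= 2 D.  This norm is invariant under u_i -> - u_i, so a
   discrete Steiner symmetrization along each of the three axes (each fibre, all
   of whose points have the same parity, is replaced by as many points closest
   to 1/2) keeps both the cardinality and the diameter bound.  After it, two
   points u, v of the set satisfy max(|u_i - v_i|, r(u_i) + r(v_i)) <= D and
   sum_i max(|u_i - v_i|, r(u_i) + r(v_i)) <= 2 D, where r(t) is the number of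
   integers of the parity of t that are closer to 1/2 than t.  A point of the
   symmetrized set outside S_{3,D} is then mapped to a point of S_{3,D} at
   distance more than D from it, hence outside the set, by a map which is
   injective; for even D this is preceded by reflections u_i -> 1 - u_i. *)
Require Import Defs.
From mathcomp Require Import all_boot all_order all_algebra.
From mathcomp Require Import boolp classical_sets functions cardinality.
From mathcomp Require Import finmap zify.

Import Order.TTheory GRing.Theory Num.Theory.

Local Open Scope classical_set_scope.
Local Open Scope ring_scope.

(** * Compression along the axes *)

Notation int3 := (int * (int * int))%type.

Definition even_sum (u : int3) : bool := (2 %| u.1 + (u.2.1 + u.2.2))%Z.

Definition close (D : nat) (u v : int3) : Prop :=
  [/\ `|u.1 - v.1| <= D%:Z, `|u.2.1 - v.2.1| <= D%:Z, `|u.2.2 - v.2.2| <= D%:Z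
    & `|u.1 - v.1| + `|u.2.1 - v.2.1| + `|u.2.2 - v.2.2| <= (2 * D)%:Z].

Definition close_seq (D : nat) (s : seq int3) : Prop :=
  {in s &, forall u v, close D u v}.

(* The number of integers of the parity of [t] that are closer to 1/2. *)
Definition rk (t : int) : int := Num.max (t - 1) (- t).

(* The integer of rank [r] with the parity of [t]. *)
Definition at_rk (r : nat) (t : int) : int :=
  if (2 %| r.+1%:Z - t)%Z then r.+1%:Z else - r%:Z.

Definition fiber (s : seq int3) (b : int * int) : seq int :=
  [seq u.1 | u <- s & u.2 == b].

(** Which point of a fibre receives which rank depends on the order of the list; for duplicate-free
    [s] of even points the resulting set does not. *)
Definition compress (s : seq int3) : seq int3 :=
  [seq (at_rk (index u.1 (fiber s u.2)) u.1, u.2) | u <- s].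

Lemma mem_fiber (s : seq int3) (t : int) (b : int * int) :
  (t \in fiber s b) = ((t, b) \in s).
Proof.
apply/mapP/idP => [[[a c]]|tbs].
  by rewrite mem_filter /= => /andP[/eqP-> acs] ->.
by exists (t, b); rewrite // mem_filter eqxx.
Qed.

Lemma fiber_uniq (s : seq int3) (b : int * int) : uniq s -> uniq (fiber s b).
Proof.
move=> us; rewrite map_inj_in_uniq ?filter_uniq // => -[a c] [a' c'].
by rewrite !mem_filter /= => /andP[/eqP-> _] /andP[/eqP-> _] ->.
Qed.

Lemma compress_uniq (s : seq int3) :
  uniq s -> all even_sum s -> uniq (compress s).
Proof.
move=> us /allP es; rewrite map_inj_in_uniq // => -[t b] [t' b'] us1 vs1 /= [+ bb'].
rewrite -{b'}bb' in vs1 *.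
have := es _ us1; have := es _ vs1; rewrite /even_sum /= => e1 e2 eqr.
congr pair; rewrite -mem_fiber in us1; rewrite -mem_fiber in vs1.
rewrite -(nth_index 0 us1) -(nth_index 0 vs1); congr nth.
move: eqr; rewrite /at_rk; move: (index t _) (index t' _) => i j.
by do 2![case: ifP] => ? ?; lia.
Qed.

Lemma mem_compress (s : seq int3) (t : int) (b : int * int) :
  uniq s -> all even_sum s ->
  ((t, b) \in compress s) = even_sum (t, b) && (rk t < (size (fiber s b))%:Z).
Proof.
move=> us /allP es; apply/mapP/andP => [[[a c] acs /= [-> ->]]|[et rt]].
  have := es _ acs; rewrite -mem_fiber -index_mem in acs; move: acs.
  by rewrite /even_sum /at_rk /rk /=; case: ifP; lia.
have [r rE] : exists r : nat, rk t = r%:Z by exists (absz (rk t)); rewrite /rk; lia.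
have rs : (r < size (fiber s b))%N by lia.
have := mem_nth 0 rs; rewrite mem_fiber => ns.
exists (nth 0 (fiber s b) r, b); rewrite //= index_uniq ?fiber_uniq //.
congr pair; move: (es _ ns) et rE; rewrite /even_sum /at_rk /rk /=.
move: (nth 0 _ r) => x.
by case: ifP; lia.
Qed.

Lemma compress_even (s : seq int3) :
  uniq s -> all even_sum s -> all even_sum (compress s).
Proof.
by move=> us es; apply/allP => -[t b]; rewrite mem_compress // => /andP[].
Qed.

Lemma min_max_mem (x : int) (s : seq int) :
  exists lo hi, [/\ lo \in x :: s, hi \in x :: s
    & forall y, y \in x :: s -> lo <= y <= hi].
Proof.
elim: s => [|y s [lo [hi [los his lh]]]].
  by exists x, x; split; rewrite ?mem_head // => y; rewrite inE => /eqP->; lia.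
exists (Num.min lo y), (Num.max hi y); split.
- move: los; rewrite /Order.min !inE; case: ifP => _; last by rewrite eqxx orbT.
  by move=> /orP[]->; rewrite ?orbT.
- move: his; rewrite /Order.max !inE; case: ifP => _; first by rewrite eqxx orbT.
  by move=> /orP[]->; rewrite ?orbT.
- move=> z; rewrite !inE => /or3P[/eqP->|/eqP->|zs].
  + by have := lh x (mem_head _ _); lia.
  + by lia.
  + by have /lh : z \in x :: s; [rewrite inE zs orbT|lia].
Qed.

(** Numbers of one parity are determined by half their distance to [lo], an integer between 0 and
    [(hi - lo) / 2]. *)
Lemma size_same_parity (s : seq int) (lo hi : int) : uniq s ->
  lo \in s -> (forall y, y \in s -> lo <= y <= hi) ->
  (forall x y, x \in s -> y \in s -> (2 %| x - y)%Z) ->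
  2 * (size s)%:Z - 2 <= hi - lo.
Proof.
move=> us los lh par.
have /andP[_ lohi] := lh _ los.
pose f t := (absz (t - lo))./2.
have : (size (map f s) <= size (iota 0 (absz (hi - lo))./2.+1))%N.
  apply: uniq_leq_size.
    rewrite map_inj_in_uniq // => x y xs ys; rewrite /f.
    by have [[[? ?] ?] ?] := (lh _ xs, lh _ ys, par _ _ xs los, par _ _ ys los); lia.
  move=> _ /mapP[x xs ->]; rewrite mem_iota /f.
  by have := lh _ xs; lia.
by rewrite size_map size_iota; lia.
Qed.

(* If the fibres over two bases have [m] and [m'] points, adding
   [max - min' <= K] and [max' - min <= K] gives [m + m' - 2 <= K]; two points
   of ranks [r] and [r'] differ by at most [r + r' + 1], and parity saves the
   extra [1]. *)
Lemma compress_close (D : nat) (s : seq int3) :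
  uniq s -> all even_sum s -> close_seq D s -> close_seq D (compress s).
Proof.
move=> us es Ds [t b] [t' b'].
rewrite !mem_compress // => /andP[et rt] /andP[et' rt'].
have ends c : 0 < (size (fiber s c))%:Z -> exists lo hi,
    [/\ (lo, c) \in s, (hi, c) \in s
      & 2 * (size (fiber s c))%:Z - 2 <= hi - lo].
  have par x y : x \in fiber s c -> y \in fiber s c -> (2 %| x - y)%Z.
    rewrite !mem_fiber => /(allP es) ex /(allP es).
    by move: ex; rewrite /even_sum /=; lia.
  have ufi := fiber_uniq _ c us; move: par ufi (mem_fiber s ^~ c).
  case: (fiber s c) => [//|x f] par ufi mf _.
  have [lo [hi [lof hif lh]]] := min_max_mem x f.
  exists lo, hi; rewrite -!mf; split=> //.
  exact: size_same_parity.
have [|lo [hi [los his lh]]] := ends b; first by move: rt; rewrite /rk; lia.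
have [|lo' [hi' [los' his' lh']]] := ends b'; first by move: rt'; rewrite /rk; lia.
have := Ds _ _ his los'; have := Ds _ _ los his'; move: (allP es _ los) (allP es _ los').
move: (allP es _ his) (allP es _ his') et et' rt rt' lh lh'.
rewrite /even_sum /close /rk /= => e1 e2 e3 e4 e5 e6 rt rt' lh lh'.
case=> c1 c2 c3 c4 [d1 d2 d3 d4].
by split; lia.
Qed.

Definition lower (t' t : int) : bool := (rk t' <= rk t) && (2 %| t' - t)%Z.

Definition stable1 (s : seq int3) : Prop := forall t' t b c,
  lower t' t -> (t, (b, c)) \in s -> (t', (b, c)) \in s.

Definition stable2 (s : seq int3) : Prop := forall t' t a c,
  lower t' t -> (a, (t, c)) \in s -> (a, (t', c)) \in s.

Definition stable3 (s : seq int3) : Prop := forall t' t a b,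
  lower t' t -> (a, (b, t)) \in s -> (a, (b, t')) \in s.

(** A compressed fibre depends only on its size and parity, so inclusions between fibres survive.
    Hence compressing one axis keeps the stability already gained along the others. *)
Lemma compress_mono (s : seq int3) (b b' : int * int) (t : int) :
  uniq s -> all even_sum s -> (2 %| (b'.1 + b'.2) - (b.1 + b.2))%Z ->
  (forall a, (a, b) \in s -> (a, b') \in s) ->
  (t, b) \in compress s -> (t, b') \in compress s.
Proof.
move=> us es par bb'; rewrite !mem_compress // => /andP[et rt].
have : (size (fiber s b) <= size (fiber s b'))%N.
  apply: uniq_leq_size; first exact: fiber_uniq.
  by move=> a; rewrite !mem_fiber; apply: bb'.
by move: et rt par; rewrite /even_sum /=; lia.
Qed.

Lemma compress_stable1 (s : seq int3) :
  uniq s -> all even_sum s -> stable1 (compress s).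
Proof.
move=> us es t' t b c /andP[rt par].
rewrite !mem_compress // => /andP[+ +]; move: rt par.
by rewrite /even_sum /=; lia.
Qed.

Lemma compress_stable2 (s : seq int3) :
  uniq s -> all even_sum s -> stable2 s -> stable2 (compress s).
Proof.
move=> us es s2 t' t a c tt'; apply: compress_mono => //=.
  by move: tt'; rewrite /lower; lia.
by move=> a'; apply: s2.
Qed.

Lemma compress_stable3 (s : seq int3) :
  uniq s -> all even_sum s -> stable3 s -> stable3 (compress s).
Proof.
move=> us es s3 t' t a b tt'; apply: compress_mono => //=.
  by move: tt'; rewrite /lower; lia.
by move=> a'; apply: s3.
Qed.

Definition rot3 (u : int3) : int3 := (u.2.1, (u.2.2, u.1)).

Lemma rot3_inj : injective rot3.
Proof. by move=> [a [b c]] [a' [b' c']] [-> -> ->]. Qed.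

Lemma mem_rot3 (s : seq int3) (a b c : int) :
  ((b, (c, a)) \in map rot3 s) = ((a, (b, c)) \in s).
Proof. exact: (mem_map rot3_inj s (a, (b, c))). Qed.

Lemma rot3_even (s : seq int3) : all even_sum s -> all even_sum (map rot3 s).
Proof.
move=> /allP es; apply/allP => _ /mapP[[a [b c]] /es + ->].
by rewrite /even_sum /=; lia.
Qed.

Lemma rot3_close (D : nat) (s : seq int3) :
  close_seq D s -> close_seq D (map rot3 s).
Proof.
move=> Ds _ _ /mapP[u us ->] /mapP[v vs ->]; have [] := Ds _ _ us vs.
by rewrite /close /=; split; lia.
Qed.

Definition gap (t t' : int) : int := Num.max `|t - t'| (rk t + rk t').

Definition gapped (D : nat) (u v : int3) : Prop :=
  [/\ gap u.1 v.1 <= D%:Z, gap u.2.1 v.2.1 <= D%:Z, gap u.2.2 v.2.2 <= D%:Z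
    & gap u.1 v.1 + gap u.2.1 v.2.1 + gap u.2.2 v.2.2 <= (2 * D)%:Z].

Definition gapped_seq (D : nat) (s : seq int3) : Prop :=
  {in s &, forall u v, gapped D u v}.

(** If [t] and [t'] lie on the same side of 1/2, moving [t'] to the other side, one rank lower,
    gives distance [rk t + rk t']. If they lie on opposite sides, or [t'] has rank 0, [x = t']
    works. *)
Lemma gap_attained (t t' : int) :
  exists2 x, lower x t' & gap t t' = `|t - x|.
Proof.
rewrite /gap /lower /rk.
case: (boolP (((0 < t) == (0 < t')) && (t' != 1) && (t' != 0))) => h.
  by case: (lerP t' 0) => ?; [exists (- t')|exists (2 - t')]; lia.
by exists t'; lia.
Qed.

Lemma stable_gapped (D : nat) (s : seq int3) :
  stable1 s -> stable2 s -> stable3 s -> close_seq D s -> gapped_seq D s.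
Proof.
move=> s1 s2 s3 Ds [a [b c]] [a' [b' c']] us vs.
have [x xa' gx] := gap_attained a a'.
have [y yb' gy] := gap_attained b b'.
have [z zc' gz] := gap_attained c c'.
have ws : (x, (y, z)) \in s by apply: s1 xa' _; apply: s2 yb' _; apply: s3 zc' _.
by have := Ds _ _ us ws; rewrite /close /gapped /= gx gy gz.
Qed.

(** The axes are rotated into first position and compressed in turn. The result stays in rotated
    coordinates, all conditions being invariant under cyclic permutation. *)
Lemma exists_gapped (D : nat) (s : seq int3) :
  uniq s -> all even_sum s -> close_seq D s ->
  exists s', [/\ size s' = size s, uniq s', all even_sum s' & gapped_seq D s'].
Proof.
move=> us es Ds.
pose s1 := compress s; pose r1 := map rot3 s1.
have us1 : uniq s1 by exact: compress_uniq.
have es1 : all even_sum s1 by exact: compress_even.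
have Ds1 : close_seq D s1 by exact: compress_close.
have ur1 : uniq r1 by rewrite (map_inj_uniq rot3_inj).
have er1 : all even_sum r1 by exact: rot3_even.
pose s2 := compress r1; pose r2 := map rot3 s2.
have us2 : uniq s2 by exact: compress_uniq.
have es2 : all even_sum s2 by exact: compress_even.
have Ds2 : close_seq D s2 by apply: compress_close => //; exact: rot3_close.
have ur2 : uniq r2 by rewrite (map_inj_uniq rot3_inj).
have er2 : all even_sum r2 by exact: rot3_even.
have st1 := compress_stable1 _ us es.
have st2 := compress_stable1 _ ur1 er1.
have st13 : stable3 s2.
  apply: compress_stable3 => // t' t a b tt'; rewrite !mem_rot3; exact: st1.
exists (compress r2); split; rewrite ?compress_uniq ?compress_even //.
  by rewrite !size_map.
apply: stable_gapped; first exact: compress_stable1.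
- by apply: compress_stable2 => // t' t a b tt'; rewrite !mem_rot3; exact: st13.
- by apply: compress_stable3 => // t' t a b tt'; rewrite !mem_rot3; exact: st2.
- by apply: compress_close => //; exact: rot3_close.
Qed.

(** * Folding a compressed set into the extremal set *)

(** On points of even sum, this is [S_PQ 3 k.+1 k] in the coordinates of [root_coords]. *)
Definition in_S_odd (k : nat) (u : int3) : bool :=
  [&& rk u.1 <= k%:Z, rk u.2.1 <= k%:Z, rk u.2.2 <= k%:Z
    & rk u.1 + rk u.2.1 + rk u.2.2 <= (2 * k)%:Z].

(** Likewise [S_PQ 3 k k], the ball of radius [k] about 0; hence absolute values in place of
    ranks. *)
Definition in_S_even (k : nat) (u : int3) : bool :=
  [&& `|u.1| <= k%:Z, `|u.2.1| <= k%:Z, `|u.2.2| <= k%:Z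
    & `|u.1| + `|u.2.1| + `|u.2.2| <= (2 * k)%:Z].

(* For [D = 2 * k + 1], [2 * k + 1] is the largest possible sum of ranks; all
   signs are flipped and the first rank is lowered by 1 to keep the sum even. *)
Definition fold_odd (k : nat) (u : int3) : int3 :=
  if in_S_odd k u then u
  else (if 0 < u.1 then 2 - u.1 else - u.1, (1 - u.2.1, 1 - u.2.2)).

Lemma gapped_close (D : nat) (u v : int3) : gapped D u v -> close D u v.
Proof. by rewrite /gapped /gap /close => -[? ? ? ?]; split; lia. Qed.

Lemma gapped_rk (D : nat) (u : int3) : gapped D u u ->
  [/\ 2 * rk u.1 <= D%:Z, 2 * rk u.2.1 <= D%:Z, 2 * rk u.2.2 <= D%:Z
    & rk u.1 + rk u.2.1 + rk u.2.2 <= D%:Z].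
Proof. by rewrite /gapped /gap => -[? ? ? ?]; split; lia. Qed.

Lemma fold_odd_inj (k : nat) (s : seq int3) :
  all even_sum s -> gapped_seq (2 * k).+1 s -> {in s &, injective (fold_odd k)}.
Proof.
move=> /allP es gs.
(* A point outside has total rank [2k + 1]. Folding displaces each coordinate by twice its rank,
   plus 1 on the last two axes: [4k + 4] in all, more than [2D = 4k + 2]. *)
have moved u v : u \in s -> v \in s -> ~~ in_S_odd k u -> fold_odd k u <> v.
  move=> us vs iu; rewrite /fold_odd (negPf iu) => fuv.
  have := gapped_close _ _ _ (gs _ _ us vs); have := gapped_rk _ _ (gs _ _ us us).
  move: iu (es _ us); rewrite -{v}fuv in vs *; case: u us vs => a [b c] _ _.
  rewrite /in_S_odd /even_sum /close /rk /= => iu eu [? ? ? ?] [_ _ _].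
  by case: ifP => ?; lia.
move=> u v us vs fuv; have [iu|iu] := boolP (in_S_odd k u); last first.
  have [iv|iv] := boolP (in_S_odd k v).
    by case: (moved _ _ us vs iu); rewrite fuv /fold_odd iv.
  (* On the first axis the fold identifies 1 with -1 and 2 with 0. The ranks in each pair differ, so
     equality of total ranks separates them. *)
  have top w : w \in s -> ~~ in_S_odd k w ->
      rk w.1 + rk w.2.1 + rk w.2.2 = (2 * k).+1%:Z.
    move=> ws; have [] := gapped_rk _ _ (gs _ _ ws ws).
    by rewrite /in_S_odd; case: w {ws} => a [b c] /=; lia.
  move: fuv (top _ us iu) (top _ vs iv); rewrite /fold_odd (negPf iu) (negPf iv).
  case: u v {us vs iu iv} => [a [b c]] [a' [b' c']]; rewrite /rk /=.
  by case: ifP => ?; case: ifP => ? [? ? ?] ? ?; do !congr pair; lia.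
have [iv|iv] := boolP (in_S_odd k v).
  by move: fuv; rewrite /fold_odd iu iv.
by case: (moved _ _ vs us iv); rewrite -fuv /fold_odd iu.
Qed.

(** Outside, the total rank is [2k + 1] while the last two ranks are at most [k] each, so the first
    is positive and does drop by 1. *)
Lemma fold_odd_in_S (k : nat) (u : int3) :
  even_sum u -> gapped (2 * k).+1 u u ->
  even_sum (fold_odd k u) && in_S_odd k (fold_odd k u).
Proof.
move=> eu /gapped_rk; rewrite /fold_odd; case: ifPn => [->|]; first by rewrite eu.
case: u eu => a [b c]; rewrite /even_sum /in_S_odd /rk /=.
move=> eu iu [? ? ? ?].
by case: ifP => ?; apply/andP; split; lia.
Qed.

(* [t -> 1 - t] flips the sign and keeps the rank.  A point with [u_i = k + 1] is
   moved to the opposite face [u_i = - k]; the remaining points outside have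
   three positive coordinates and ranks of sum [2 * k - 1]. *)
Definition fold_even (k : nat) (u : int3) : int3 :=
  if u.1 == k.+1 then (1 - u.1, (1 - u.2.1, u.2.2)) else
  if u.2.1 == k.+1 then (u.1, (1 - u.2.1, 1 - u.2.2)) else
  if u.2.2 == k.+1 then (1 - u.1, (u.2.1, 1 - u.2.2)) else
  if in_S_even k u then u else (- u.1, (1 - u.2.1, 1 - u.2.2)).

(** Absolute values of nonpositive coordinates are their ranks, so under this normalization the
    points of maximal total rank in a gapped set lie in the ball [in_S_even]. *)
Definition top_nonpos (k : nat) (u : int3) : bool :=
  (rk u.1 + rk u.2.1 + rk u.2.2 == (2 * k)%:Z) ==>
  [&& u.1 <= 0, u.2.1 <= 0 & u.2.2 <= 0].

Lemma rk_gt0 (t : int) : 0 < t -> rk t = t - 1.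
Proof. by rewrite /rk; lia. Qed.

Lemma rk_le0 (t : int) : t <= 0 -> rk t = - t.
Proof. by rewrite /rk; lia. Qed.

(** The sum of absolute values is the total rank plus the number of positive coordinates. Outside it
    is at least [2k + 2] by parity, while a positive coordinate forces total rank at most [2k - 1];
    so all three are positive. *)
Lemma notin_S_even (k : nat) (u : int3) :
  even_sum u -> gapped (2 * k) u u -> top_nonpos k u ->
  u.1 != k.+1 -> u.2.1 != k.+1 -> u.2.2 != k.+1 -> ~~ in_S_even k u ->
  [/\ 0 < u.1, 0 < u.2.1, 0 < u.2.2 & u.1 + u.2.1 + u.2.2 = (2 * k + 2)%:Z].
Proof.
move=> + /gapped_rk; case: u => a [b c].
rewrite /even_sum /top_nonpos /in_S_even /=.
case: (lerP a 0) => sa; case: (lerP b 0) => sb; case: (lerP c 0) => sc;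
rewrite ?(rk_gt0 _ sa) ?(rk_le0 _ sa) ?(rk_gt0 _ sb) ?(rk_le0 _ sb)
  ?(rk_gt0 _ sc) ?(rk_le0 _ sc) ?(ler0_norm sa) ?(ler0_norm sb)
  ?(ler0_norm sc) ?(gtr0_norm sa) ?(gtr0_norm sb) ?(gtr0_norm sc).
all: move=> eu [? ? ? ?] tu na nb nc iu.
all: split; lia.
Qed.

(** The strict bounds on the faces come from [top_nonpos]: the coordinate [k + 1] is positive of
    rank [k], so the total rank is below [2k]. *)
Variant fold_even_spec (k : nat) : int3 -> int3 -> Prop :=
| Fold_face1 b c of rk b + rk c < k%:Z & (2 %| k.+1%:Z + (b + c))%Z :
    fold_even_spec k (k.+1%:Z, (b, c)) (- k%:Z, (1 - b, c))
| Fold_face2 a c of rk a + rk c < k%:Z & (2 %| k.+1%:Z + (a + c))%Z :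
    fold_even_spec k (a, (k.+1%:Z, c)) (a, (- k%:Z, 1 - c))
| Fold_face3 a b of rk a + rk b < k%:Z & (2 %| k.+1%:Z + (a + b))%Z :
    fold_even_spec k (a, (b, k.+1%:Z)) (1 - a, (b, - k%:Z))
| Fold_in u of even_sum u & in_S_even k u : fold_even_spec k u u
| Fold_corner a b c of [/\ 0 < a <= k%:Z, 0 < b <= k%:Z & 0 < c <= k%:Z]
    & a + b + c = (2 * k + 2)%:Z :
    fold_even_spec k (a, (b, c)) (- a, (1 - b, 1 - c)).

Lemma fold_evenP (k : nat) (u : int3) :
  even_sum u -> gapped (2 * k) u u -> top_nonpos k u ->
  fold_even_spec k u (fold_even k u).
Proof.
move=> eu gu tu; rewrite /fold_even.
case: ifPn => [|na]; last case: ifPn => [|nb]; last case: ifPn => [|nc].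
- case: u eu gu tu => a [b c] + /gapped_rk + + /= /eqP aE; rewrite {a}aE.
  rewrite /even_sum /top_nonpos /= rk_gt0 // => eu [? ? ? ?] tu.
  by rewrite [1 - _](_ : _ = - k%:Z); [constructor; lia|lia].
- case: u eu gu tu na => a [b c] + /gapped_rk + + /= _ /eqP bE; rewrite {b}bE.
  rewrite /even_sum /top_nonpos /= (rk_gt0 k.+1) // => eu [? ? ? ?] tu.
  by rewrite [1 - k.+1%:Z](_ : _ = - k%:Z); [constructor; lia|lia].
- case: u eu gu tu na nb => a [b c] + /gapped_rk + + /= _ _ /eqP cE; rewrite {c}cE.
  rewrite /even_sum /top_nonpos /= (rk_gt0 k.+1) // => eu [? ? ? ?] tu.
  by rewrite [1 - k.+1%:Z](_ : _ = - k%:Z); [constructor; lia|lia].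
case: ifPn => iu; first by constructor.
have [] := notin_S_even _ _ eu gu tu na nb nc iu.
have [] := gapped_rk _ _ gu; case: u {eu gu tu iu} na nb nc => a [b c] /= na nb nc.
move=> + + + _ a0 b0 c0; rewrite !rk_gt0 // => ? ? ? ?.
by constructor; [split|]; lia.
Qed.

(** On a face the bounds on the ranks only give a sum of absolute values at most [2k + 1]; evenness
    of the coordinate sum removes the excess. *)
Lemma fold_even_in_S (k : nat) (u : int3) :
  even_sum u -> gapped (2 * k) u u -> top_nonpos k u ->
  even_sum (fold_even k u) && in_S_even k (fold_even k u).
Proof.
move=> eu gu tu; case: fold_evenP => // [b c|a c|a b|v|a b c].
- by rewrite /in_S_even /even_sum /rk /= => ? ?; apply/andP; split; lia.
- by rewrite /in_S_even /even_sum /rk /= => ? ?; apply/andP; split; lia.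
- by rewrite /in_S_even /even_sum /rk /= => ? ?; apply/andP; split; lia.
- by move=> -> ->.
- by rewrite /in_S_even /even_sum /= => -[? ? ?] ?; apply/andP; split; lia.
Qed.

(** A face point moves by [2k + 1] along one axis, a corner point by [4k + 2] in total; both exceed
    the bounds for [D = 2k]. *)
Lemma fold_even_far (k : nat) (u : int3) :
  even_sum u -> gapped (2 * k) u u -> top_nonpos k u ->
  close (2 * k) u (fold_even k u) -> fold_even k u = u.
Proof.
move=> eu gu tu; case: fold_evenP => // [b c|a c|a b|a b c].
- by move=> _ _ [/= + _ _ _]; lia.
- by move=> _ _ [/= _ + _ _]; lia.
- by move=> _ _ [/= _ _ + _]; lia.
- by move=> [? ? ?] ? [/= _ _ _]; lia.
Qed.

(** In a face image the coordinates other than the [- k] replacing [k + 1] have ranks of sum below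
    [k], so neither is [- k] and the face is recovered. A corner image can have [- k] only in first
    place, and then its other ranks sum to [k]. *)
Lemma fold_even_moved_inj (k : nat) (u v : int3) :
  even_sum u -> gapped (2 * k) u u -> top_nonpos k u ->
  even_sum v -> gapped (2 * k) v v -> top_nonpos k v ->
  fold_even k u <> u -> fold_even k v <> v ->
  fold_even k u = fold_even k v -> u = v.
Proof.
move=> eu gu tu ev gv tv.
case: (fold_evenP k u) => // [b c|a c|a b|a b c];
case: (fold_evenP k v) => // [b' c'|a' c'|a' b'|a' b' c'].
- by move=> _ _ _ _ _ _ [? ->]; do !congr pair; lia.
- by rewrite /rk => ? _ _ _ _ _ [? ? ?]; exfalso; lia.
- by rewrite /rk => ? _ _ _ _ _ [? ? ?]; exfalso; lia.
- by rewrite /rk => -[? ? ?] ? ? _ _ _ [? ? ?]; exfalso; lia.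
- by rewrite /rk => ? _ _ _ _ _ [? ? ?]; exfalso; lia.
- by move=> _ _ _ _ _ _ [-> ?]; do !congr pair; lia.
- by rewrite /rk => ? _ _ _ _ _ [? ? ?]; exfalso; lia.
- by rewrite /rk => -[? ? ?] ? ? _ _ _ [? ? ?]; exfalso; lia.
- by rewrite /rk => ? _ _ _ _ _ [? ? ?]; exfalso; lia.
- by rewrite /rk => ? _ _ _ _ _ [? ? ?]; exfalso; lia.
- by move=> _ _ _ _ _ _ [? ->]; do !congr pair; lia.
- by rewrite /rk => -[? ? ?] ? ? _ _ _ [? ? ?]; exfalso; lia.
- by rewrite /rk => ? _ [? ? ?] ? _ _ [? ? ?]; exfalso; lia.
- by rewrite /rk => ? _ [? ? ?] ? _ _ [? ? ?]; exfalso; lia.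
- by rewrite /rk => ? _ [? ? ?] ? _ _ [? ? ?]; exfalso; lia.
- by move=> _ _ _ _ _ _ [? ? ?]; do !congr pair; lia.
Qed.

Lemma fold_even_inj (k : nat) (s : seq int3) :
  all even_sum s -> all (top_nonpos k) s -> gapped_seq (2 * k) s ->
  {in s &, injective (fold_even k)}.
Proof.
move=> /allP es /allP ts gs.
(* A point whose image lies in the set is close to that image, hence fixed. *)
have moved u v : u \in s -> v \in s -> fold_even k u = v -> u = v.
  move=> us vs fuv; rewrite -fuv; apply/esym/fold_even_far; rewrite ?es ?ts //.
    exact: gs.
  by rewrite fuv; apply: gapped_close; exact: gs.
move=> u v us vs fuv.
have [fu|/eqP fu] := eqVneq (fold_even k u) u.
  by apply/esym/moved => //; rewrite -fuv.
have [fv|/eqP fv] := eqVneq (fold_even k v) v.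
  by apply: moved => //; rewrite fuv.
by apply: fold_even_moved_inj fuv; rewrite ?es ?ts //; exact: gs.
Qed.

(** * Reflections normalizing the even case *)

Definition reflect_pos (p t : int) : int := if 0 < p then 1 - t else t.

Definition reflect_pos3 (p u : int3) : int3 :=
  (reflect_pos p.1 u.1, (reflect_pos p.2.1 u.2.1, reflect_pos p.2.2 u.2.2)).

Lemma reflect_pos3_inj (p : int3) : injective (reflect_pos3 p).
Proof.
have inj q : injective (reflect_pos q) by move=> t t'; rewrite /reflect_pos; case: ifP => _; lia.
by move=> [a [b c]] [a' [b' c']] [/inj-> /inj-> /inj->].
Qed.

(** Modulo 2 the total rank of [p] is its coordinate sum plus its number of positive coordinates.
    That number is therefore even, and so is the number of reflections. *)
Lemma reflect_pos3_even (k : nat) (p u : int3) : even_sum p -> even_sum u ->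
  rk p.1 + rk p.2.1 + rk p.2.2 = (2 * k)%:Z -> even_sum (reflect_pos3 p u).
Proof.
case: p u => a [b c] [a' [b' c']].
rewrite /reflect_pos3 /reflect_pos /even_sum /rk /=.
by do 3![case: ifP => ?]; lia.
Qed.

Lemma rk_reflect_pos (p t : int) : rk (reflect_pos p t) = rk t.
Proof. by rewrite /rk /reflect_pos; case: ifP; lia. Qed.

Lemma gap_reflect_pos (p t t' : int) :
  gap (reflect_pos p t) (reflect_pos p t') = gap t t'.
Proof. by rewrite /gap !rk_reflect_pos /reflect_pos; case: ifP; lia. Qed.

(** Across 1/2 the distance is [rk t + rk t' + 1]. Two points of total rank [2k] already exhaust the
    bound [4k] on the sum of gaps, which leaves no room for this extra 1. *)
Lemma gap_sign (t t' : int) :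
  rk t + rk t' + ((0 < t) != (0 < t') : nat)%:Z <= gap t t'.
Proof. by rewrite /gap /rk; case: (lerP t 0); case: (lerP t' 0); lia. Qed.

(* Two points of maximal total rank have the same sign pattern. *)
Lemma top_reflect_pos (k : nat) (p u : int3) :
  rk p.1 + rk p.2.1 + rk p.2.2 = (2 * k)%:Z -> gapped (2 * k) p u ->
  top_nonpos k (reflect_pos3 p u).
Proof.
rewrite /top_nonpos /= !rk_reflect_pos; case: p u => a [b c] [a' [b' c']].
rewrite /gapped /reflect_pos /= => tp [_ _ _].
move: tp (gap_sign a a') (gap_sign b b') (gap_sign c c').
move: (gap a a') (gap b b') (gap c c').
move: (rk a) (rk b) (rk c) (rk a') (rk b') (rk c') => *.
apply/implyP => /eqP tu.
have [sa sb sc] : [/\ (0 < a) = (0 < a'), (0 < b) = (0 < b') & (0 < c) = (0 < c')].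
  by split; lia.
by rewrite sa sb sc; apply/and3P; split; case: ifP; lia.
Qed.

Lemma exists_top_nonpos (k : nat) (s : seq int3) :
  uniq s -> all even_sum s -> gapped_seq (2 * k) s ->
  exists s', [/\ size s' = size s, uniq s', all even_sum s',
    gapped_seq (2 * k) s' & all (top_nonpos k) s'].
Proof.
move=> us es gs; pose top (u : int3) := rk u.1 + rk u.2.1 + rk u.2.2 == (2 * k)%:Z.
have [/hasP[p ps /eqP tp]|nt] := boolP (has top s); last first.
  exists s; split=> //; apply/allP => u us'; apply/implyP => tu.
  by case/hasP: nt; exists u.
exists (map (reflect_pos3 p) s); split.
- by rewrite size_map.
- by rewrite (map_inj_uniq (reflect_pos3_inj p)).
- move/allP: es => es; apply/allP => _ /mapP[u us' ->].
  by apply: (reflect_pos3_even k); rewrite ?es.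
- move=> _ _ /mapP[u us' ->] /mapP[v vs ->].
  by rewrite /gapped /= !gap_reflect_pos; exact: gs.
- apply/allP => _ /mapP[u us' ->]; exact: top_reflect_pos tp (gs _ _ ps us').
Qed.

(** * Return to the original coordinates *)

Definition root_coords (x : int3) : int3 :=
  (x.2.1 + x.2.2, (x.1 + x.2.2, x.1 + x.2.1)).

Lemma root_coords_inj : injective root_coords.
Proof.
move=> [a [b c]] [a' [b' c']] [? ? ?].
by do !congr pair; lia.
Qed.

Lemma root_coords_even (x : int3) : even_sum (root_coords x).
Proof. by case: x => a [b c]; rewrite /even_sum /=; lia. Qed.

Definition in_SPQ (P Q : nat) (x : int3) : bool :=
  (pos_part x.1 + pos_part x.2.1 + pos_part x.2.2 <= P%:Z) &&
  (pos_part (- x.1) + pos_part (- x.2.1) + pos_part (- x.2.2) <= Q%:Z).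

Lemma root_coords_onto (u : int3) : even_sum u -> exists x, root_coords x = u.
Proof.
case: u => a [b c]; rewrite /even_sum /= => /dvdzP[m mE].
(* Half the coordinate sum, [m], is the sum of the coordinates of the preimage. *)
exists (m - a, (m - b, m - c)).
by rewrite /root_coords /=; do !congr pair; lia.
Qed.

Lemma in_SPQ_odd (k : nat) (x : int3) :
  in_S_odd k (root_coords x) -> in_SPQ k.+1 k x.
Proof.
case: x => a [b c]; rewrite /in_S_odd /in_SPQ /root_coords /rk /pos_part /=.
by case: (lerP a 0); case: (lerP b 0); case: (lerP c 0); lia.
Qed.

Lemma in_SPQ_even (k : nat) (x : int3) :
  in_S_even k (root_coords x) -> in_SPQ k k x.
Proof.
case: x => a [b c]; rewrite /in_S_even /in_SPQ /root_coords /pos_part /=.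
by case: (lerP a 0); case: (lerP b 0); case: (lerP c 0); lia.
Qed.

Lemma size_le_close (D : nat) (s L : seq int3) :
  uniq s -> {in s &, forall x y, close D (root_coords x) (root_coords y)} ->
  (forall x, in_SPQ (uphalf D) D./2 x -> x \in L) -> (size s <= size L)%N.
Proof.
move=> us cs inL; pose r := map root_coords s.
have ur : uniq r by rewrite (map_inj_uniq root_coords_inj).
have er : all even_sum r.
  by apply/allP => _ /mapP[x _ ->]; exact: root_coords_even.
have cr : close_seq D r by move=> _ _ /mapP[x xs ->] /mapP[y ys ->]; exact: cs.
have [t [st ut et gt]] := exists_gapped D r ur er cr.
suff [t' [f [st' ut' fi fL]]] : exists t' : seq int3, exists f : int3 -> int3,
    [/\ size t' = size t, uniq t', {in t' &, injective f}
      & forall u, u \in t' -> f u \in map root_coords L].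
  rewrite -(size_map root_coords s) -(size_map root_coords L) -/r -st -st'.
  rewrite -(size_map f t'); apply: uniq_leq_size.
    by rewrite map_inj_in_uniq.
  by move=> _ /mapP[u us' ->]; exact: fL.
have inrL u : even_sum u -> (forall x, root_coords x = u -> x \in L) ->
    u \in map root_coords L.
  by move=> /root_coords_onto[x xu] xL; rewrite -xu map_f // xL.
have [od|ev] := boolP (odd D).
  have De : D = (2 * D./2).+1 by lia.
  rewrite De in gt; exists t, (fold_odd D./2); split=> //.
    exact: fold_odd_inj et gt.
  move=> u tu; have := fold_odd_in_S _ _ (allP et _ tu) (gt _ _ tu tu).
  case/andP=> ef fS; apply: inrL => // x xu; apply: inL.
  by rewrite uphalf_half od; apply: in_SPQ_odd; rewrite xu.
have De : D = (2 * D./2)%N by lia.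
rewrite De in gt; have [t' [st' ut' et' gt' tt']] := exists_top_nonpos _ _ ut et gt.
exists t', (fold_even D./2); split=> //; first exact: fold_even_inj et' tt' gt'.
move=> u tu.
have := fold_even_in_S _ _ (allP et' _ tu) (gt' _ _ tu tu) (allP tt' _ tu).
case/andP=> ef fS; apply: inrL => // x xu; apply: inL.
by rewrite uphalf_half (negPf ev); apply: in_SPQ_even; rewrite xu.
Qed.

(** * The size of the extremal set *)

Definition int_range (P Q : nat) : seq int :=
  [seq n%:Z | n <- iota 0 P.+1] ++ [seq - n.+1%:Z | n <- iota 0 Q].

Lemma mem_int_range (P Q : nat) (a : int) :
  (a \in int_range P Q) = (pos_part a <= P%:Z) && (pos_part (- a) <= Q%:Z).
Proof.
rewrite mem_cat /pos_part; apply/orP/andP => [[] /mapP[n]|[aP aQ]].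
- by rewrite mem_iota => ? ->; split; lia.
- by rewrite mem_iota => ? ->; split; lia.
- have [a0|a0] := leP 0 a; [left|right]; apply/mapP.
    by exists (absz a); [rewrite mem_iota|]; lia.
  by exists (absz a).-1; [rewrite mem_iota|]; lia.
Qed.

Lemma int_range_uniq (P Q : nat) : uniq (int_range P Q).
Proof.
rewrite cat_uniq !map_inj_uniq ?iota_uniq /=; [|by move=> ? ?; lia..].
by rewrite andbT; apply/hasPn => _ /mapP[n _ ->]; apply/mapP => -[m _]; lia.
Qed.

Definition left_over (P : nat) (a : int) : nat := (P - absz (pos_part a))%N.

(** Raises the dimension by one: the new coordinate [a] spends part of [P] or of [Q], and the rest
    bounds the remaining coordinates. *)
Definition extend (T : eqType) (L : nat -> nat -> seq T) (P Q : nat) :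
    seq (int * T) :=
  [seq (a, y) | a <- int_range P Q, y <- L (left_over P a) (left_over Q (- a))].

Lemma mem_extend (T : eqType) (L : nat -> nat -> seq T) (P Q : nat) (a : int)
    (y : T) :
  ((a, y) \in extend T L P Q) = [&& pos_part a <= P%:Z, pos_part (- a) <= Q%:Z
    & y \in L (left_over P a) (left_over Q (- a))].
Proof.
rewrite andbA -mem_int_range.
apply/allpairsPdep/andP => [[b [z [bs zs [-> ->]]]]|[aS yS]]; first by split.
by exists a, y; split.
Qed.

Lemma extend_uniq (T : eqType) (L : nat -> nat -> seq T) (P Q : nat) :
  (forall P' Q', uniq (L P' Q')) -> uniq (extend T L P Q).
Proof.
move=> uL; apply: allpairs_uniq_dep => //; first exact: int_range_uniq.
by move=> [a y] [b z] _ _ /= [-> ->].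
Qed.

Lemma sumn_rev_iota (f : nat -> nat) (n : nat) :
  sumn [seq f (n - i)%N | i <- iota 0 n.+1] = sumn [seq f i | i <- iota 0 n.+1].
Proof.
rewrite !sumnE !big_map -!/(index_iota 0 n.+1) big_nat_rev /=.
by apply: eq_big_nat => i /andP[_ ?]; congr f; lia.
Qed.

(** The first sum collects [a >= 0], which leaves [Q] intact; the second collects [a < 0], which
    leaves [P] intact. *)
Lemma size_extend (T : eqType) (L : nat -> nat -> seq T) (P Q : nat) :
  size (extend T L P Q) =
  (sumn [seq size (L i Q) | i <- iota 0 P.+1] +
   sumn [seq size (L P i) | i <- iota 0 Q])%N.
Proof.
rewrite size_allpairs_dep map_cat sumn_cat -!map_comp; congr addn.
  rewrite -(sumn_rev_iota (fun i => size (L i Q))); congr sumn.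
  apply/eq_in_map => n; rewrite mem_iota /= => nP.
  by congr (size (L _ _)); rewrite /left_over /pos_part; lia.
case: Q => // Q; rewrite -(sumn_rev_iota (fun i => size (L P i))); congr sumn.
apply/eq_in_map => n; rewrite mem_iota /= => nP.
by congr (size (L _ _)); rewrite /left_over /pos_part; lia.
Qed.

Definition SPQ_seq : nat -> nat -> seq int3 := extend _ (extend _ int_range).

Lemma mem_SPQ_seq (P Q : nat) (x : int3) : (x \in SPQ_seq P Q) = in_SPQ P Q x.
Proof.
case: x => a [b c]; rewrite /SPQ_seq !mem_extend mem_int_range /in_SPQ /=.
rewrite /left_over.
have pos t : exists n : nat, pos_part t = n%:Z.
  by exists (absz (pos_part t)); rewrite /pos_part; lia.
have [[pa ->] [na ->]] := (pos a, pos (- a)).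
have [[pb ->] [nb ->]] := (pos b, pos (- b)).
have [[pc ->] [nc ->]] := (pos c, pos (- c)).
by rewrite !absz_nat; lia.
Qed.

Lemma SPQ_seq_uniq (P Q : nat) : uniq (SPQ_seq P Q).
Proof. by do 2!apply: extend_uniq => ? ?; exact: int_range_uniq. Qed.

Lemma size_int_range (P Q : nat) : size (int_range P Q) = (P + Q).+1.
Proof. by rewrite size_cat !size_map !size_iota; lia. Qed.

Lemma sumn_iotaS (f : nat -> nat) (n : nat) :
  sumn [seq f i | i <- iota 0 n.+1] = (sumn [seq f i | i <- iota 0 n] + f n)%N.
Proof. by rewrite -addn1 iotaD map_cat sumn_cat /= addn0. Qed.

Lemma size_extend2 (P Q : nat) :
  (2 * size (extend _ int_range P Q) =
   (P + Q + 2) * (P + Q + 1) + 2 * (P * Q))%N.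
Proof.
rewrite size_extend.
under eq_map do rewrite size_int_range.
under [X in (_ + sumn X)%N]eq_map do rewrite size_int_range.
have H1 n : (2 * sumn [seq (i + Q).+1 | i <- iota 0 n] = n * n + n + 2 * n * Q)%N.
  by elim: n => // n IH; rewrite sumn_iotaS mulnDr IH; lia.
have H2 n : (2 * sumn [seq (P + i).+1 | i <- iota 0 n] = n * n + n + 2 * n * P)%N.
  by elim: n => // n IH; rewrite sumn_iotaS mulnDr IH; lia.
by rewrite mulnDr H1 H2; lia.
Qed.

Lemma size_SPQ_seq (P Q : nat) :
  (6 * size (SPQ_seq P Q) =
   (P + Q + 3) * (P + Q + 2) * (P + Q + 1) + 6 * ((P + Q + 1) * (P * Q)))%N.
Proof.
rewrite /SPQ_seq size_extend.
(* The boundary terms of the sums stand on the left here and in [H2], avoiding subtraction in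
   [nat]. *)
have H1 n : (6 * sumn [seq size (extend _ int_range i Q) | i <- iota 0 n.+1] +
    (Q + 2) * (Q + 1) * Q =
    (n + Q + 3) * (n + Q + 2) * (n + Q + 1) + 3 * Q * n * (n + 1))%N.
  elim: n => [|n IH]; rewrite sumn_iotaS; have := size_extend2.
    by move=> /(_ 0%N Q) /=; lia.
  by move=> /(_ n.+1 Q); lia.
have H2 n : (6 * sumn [seq size (extend _ int_range P i) | i <- iota 0 n] +
    (P + 2) * (P + 1) * P + 3 * P * n =
    (P + n + 2) * (P + n + 1) * (P + n) + 3 * P * n * n)%N.
  elim: n => [|n IH]; first by rewrite /=; lia.
  by rewrite sumn_iotaS; have := size_extend2 P n; lia.
have := H2 Q; have := H1 P.
by set x := sumn _; set y := sumn _; move: x y => x y ? ?; lia.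
Qed.

Lemma size_SD_seq (D : nat) : size (SPQ_seq (uphalf D) D./2) = M3 D.
Proof.
have := size_SPQ_seq (uphalf D) D./2; have := bin_ffact (D + 3) 3.
rewrite /M3 !ffactnS ffactn0 (_ : 3`! = 6)%N //.
(* With [k = D./2], both sides are [k * k] or [(k + 1) * k] according to parity. *)
have -> : (D ^ 2 %/ 4 = uphalf D * D./2)%N.
  rewrite uphalf_half; set k := D./2; have -> : D = (odd D + 2 * k)%N by lia.
  by case: (odd D) => /=; lia.
have -> : (uphalf D + D./2 = D)%N by lia.
by move: (uphalf D * D./2)%N ('C(D + 3, 3)) (size _) => x y z; nia.
Qed.

(** * Transfer to row vectors *)

Lemma card_le_seq (T : choiceType) (A : set T) (m : nat) :
  (forall s : seq T, uniq s -> (forall x, x \in s -> A x) -> (size s <= m)%N) ->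
  (A #<= `I_m)%card.
Proof.
move=> bound; have [/finite_setP[n An]|infA] := pselect (finite_set A).
  have fA : finite_set A by apply/finite_setP; exists n.
  rewrite (card_le_eql An) card_le_II -(card_fset_set An).
  apply: bound => [|x xA]; first exact: fset_uniq.
  by apply/set_mem; rewrite -(in_fset_set fA x).
(* An infinite set would contain [m + 1] points, against the bound. *)
have [B BA mB] := infinite_set_fset m.+1 infA.
suff : (size (enum_fset B) <= m)%N by lia.
by apply: bound => // x xB; exact: BA.
Qed.

Lemma card_eq_seq (T : choiceType) (A : set T) (s : seq T) :
  uniq s -> (forall x, A x <-> x \in s) -> (A #= `I_(size s))%card.
Proof.
move=> us As.
have -> : A = [set` seq_fset tt s].
  apply/seteqP; split=> x.
    by move=> /As xs; rewrite /= (seq_fsetE tt s x).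
  by rewrite /= (seq_fsetE tt s x) => /As.
by apply/card_eq_fsetP; rewrite size_seq_fset undup_id.
Qed.

(** One definition serves Z^3 ([n = 0]) and the root lattice in Z^4 ([n = 1]), whose last coordinate
    is determined by the others. *)
Definition coords (n : nat) (x : 'rV[int]_n.+3) : int3 :=
  (x 0 ord0, (x 0 (lift ord0 ord0), x 0 (lift ord0 (lift ord0 ord0)))).

Lemma coords_inj : injective (@coords 0).
Proof.
move=> x y [e0 e1 e2]; apply/rowP => i.
case: (unliftP ord0 i) => [j|] -> //; case: (unliftP ord0 j) => [k|] -> //.
by rewrite (ord1 k).
Qed.

Definition row3 (x : int3) : 'rV[int]_3 :=
  \row_i [:: x.1; x.2.1; x.2.2]`_i.

Lemma row3K : cancel row3 (@coords 0).
Proof. by move=> [a [b c]]; rewrite /coords !mxE. Qed.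

Lemma coordsK : cancel (@coords 0) row3.
Proof. by move=> x; apply: coords_inj; rewrite row3K. Qed.

Definition row4 (x : int3) : 'rV[int]_4 :=
  \row_i [:: x.1; x.2.1; x.2.2; - (x.1 + x.2.1 + x.2.2)]`_i.

Lemma row4K : cancel row4 (@coords 1).
Proof. by move=> [a [b c]]; rewrite /coords !mxE. Qed.

Lemma row4_root_lattice (x : int3) : root_lattice 3 (row4 x).
Proof.
by case: x => a [b c]; rewrite /root_lattice /= !big_ord_recl big_ord0 !mxE /=; lia.
Qed.

Lemma coordsK4 (z : 'rV[int]_4) : root_lattice 3 z -> row4 (coords 1 z) = z.
Proof.
rewrite /root_lattice /= !big_ord_recl big_ord0 => zr; apply/rowP => i.
rewrite mxE /coords /=.
case: (unliftP ord0 i) => [j|] ->; last by [].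
case: (unliftP ord0 j) => [k|] ->; last by [].
case: (unliftP ord0 k) => [l|] ->; last by [].
by rewrite (ord1 l : l = ord0) /=; move: zr;
  move: (z 0 _) (z 0 _) (z 0 _) (z 0 _) => *; lia.
Qed.

Lemma S_D_in_SPQ (D : nat) (x : 'rV[int]_3) :
  S_D 3 D x <-> in_SPQ (uphalf D) D./2 (coords 0 x).
Proof.
rewrite /S_D /S_PQ /in_SPQ /coords /= !big_ord_recl !big_ord0.
rewrite !addr0 !addrA.
by split=> [[-> ->]|/andP].
Qed.

Lemma dist_a_close (D : nat) (x y : 'rV[int]_3) :
  dist_a x y <= D%:R ->
  close D (root_coords (coords 0 x)) (root_coords (coords 0 y)).
Proof.
rewrite /dist_a !big_ord_recl !big_ord0 natz /coords /root_coords /close /=.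
move: (x 0 _) (x 0 _) (x 0 _) (y 0 _) (y 0 _) (y 0 _) => a b c a' b' c'.
rewrite /pos_part => h.
by split; lia.
Qed.

Lemma dist_A_close (D : nat) (z w : 'rV[int]_4) :
  root_lattice 3 z -> root_lattice 3 w -> dist_A z w <= D%:R ->
  close D (root_coords (coords 1 z)) (root_coords (coords 1 w)).
Proof.
rewrite /root_lattice /dist_A /= ler_pdivrMl // -natrM pmulrn ler_int.
rewrite !big_ord_recl !big_ord0 /coords /root_coords /close /=.
move: (z 0 _) (z 0 _) (z 0 _) (z 0 _) (w 0 _) (w 0 _) (w 0 _) (w 0 _).
move=> a b c d a' b' c' d' h1 h2 h3.
by split; lia.
Qed.

Lemma dist_A_le (D : nat) (x y : int3) :
  in_SPQ (uphalf D) D./2 x -> in_SPQ (uphalf D) D./2 y ->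
  dist_A (row4 x) (row4 y) <= D%:R.
Proof.
rewrite /dist_A /= ler_pdivrMl // -natrM pmulrn ler_int.
rewrite !big_ord_recl !big_ord0 !mxE /=.
case: x y => a [b c] [a' [b' c']]; rewrite /in_SPQ /=.
have -> : D = (uphalf D + D./2)%N by lia.
move: (uphalf D) (D./2) => P Q.
have pos t : exists p q : nat, [/\ pos_part t = p%:Z, pos_part (- t) = q%:Z & t = p%:Z - q%:Z].
  by exists (absz (pos_part t)), (absz (pos_part (- t))); rewrite /pos_part; split; lia.
have [[pa [na [-> -> ->]]] [qa [ma [-> -> ->]]]] := (pos a, pos a').
have [[pb [nb [-> -> ->]]] [qb [mb [-> -> ->]]]] := (pos b, pos b').
have [[pc [nc [-> -> ->]]] [qc [mc [-> -> ->]]]] := (pos c, pos c').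
by lia.
Qed.

Lemma dist_a_le (D : nat) (x y : 'rV[int]_3) :
  S_D 3 D x -> S_D 3 D y -> dist_a x y <= D%:R.
Proof.
move=> [xP xQ] [yP yQ]; rewrite /dist_a.
(* Subadditivity of the positive part bounds the distance by [uphalf D + D./2 = D]. *)
have sub (z w : 'rV[int]_3) : \sum_(i < 3) pos_part (z 0 i - w 0 i) <=
    \sum_(i < 3) pos_part (z 0 i) + \sum_(i < 3) pos_part (- w 0 i).
  by rewrite -big_split; apply: ler_sum => i _ /=; rewrite /pos_part; lia.
have := sub x y; have := sub y x; move: xP xQ yP yQ.
by do ![set u := (\sum_(i < 3) _); move: u => ?]; rewrite natz; lia.
Qed.

(* [A #<= `I_m] says that A is finite with at most m elements, and
   [A #= `I_m] that A has exactly m elements. *)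
Theorem theorem1p1 (D : nat) :
  [/\ forall F : set 'rV[int]_3,
        diam_le (@dist_a 3) F D -> (F #<= `I_(M3 D))%card,
      (S_D 3 D #= `I_(M3 D))%card,
      has_diam (@dist_a 3) (S_D 3 D) D,
      forall G : set 'rV[int]_4,
        G `<=` root_lattice 3 -> diam_le (@dist_A 3) G D ->
        (G #<= `I_(M3 D))%card
    & exists G : set 'rV[int]_4,
        [/\ G `<=` root_lattice 3, diam_le (@dist_A 3) G D
          & (G #= `I_(M3 D))%card]].
Proof.
move: (SPQ_seq (uphalf D) D./2) (size_SD_seq D) (SPQ_seq_uniq (uphalf D) D./2)
  (mem_SPQ_seq (uphalf D) D./2) => L sL uL mL.
have bound (T : choiceType) (f : T -> int3) (F : set T) :
    {in F &, injective f} -> (forall x y, F x -> F y ->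
      close D (root_coords (f x)) (root_coords (f y))) -> (F #<= `I_(M3 D))%card.
  move=> fi fc; apply: card_le_seq => s us sF; rewrite -sL -(size_map f).
  apply: (size_le_close D) => [||x]; last by rewrite mL.
    by rewrite map_inj_in_uniq // => x y /sF/mem_set xs /sF/mem_set ys; exact: fi.
  by move=> _ _ /mapP[x /sF xs ->] /mapP[y /sF ys ->]; exact: fc.
split.
- move=> F FD; apply: (bound _ (coords 0)) => [x y _ _ /coords_inj //|x y Fx Fy].
  exact: dist_a_close (FD _ _ Fx Fy).
- rewrite -sL -(size_map row3); apply: card_eq_seq => [|x].
    by rewrite (map_inj_uniq (can_inj row3K)).
  by rewrite S_D_in_SPQ -mL -(mem_map (can_inj row3K)) coordsK.
- split=> [x y xS yS|]; first exact: dist_a_le.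
  (* Opposite extreme points on the first axis realize the diameter. *)
  exists (row3 ((uphalf D)%:Z, (0, 0))), (row3 (- D./2%:Z, (0, 0))).
  split; [apply/S_D_in_SPQ|apply/S_D_in_SPQ|].
  + by rewrite row3K /in_SPQ /pos_part /=; lia.
  + by rewrite row3K /in_SPQ /pos_part /=; lia.
  + by rewrite /dist_a !big_ord_recl !big_ord0 !mxE natz /pos_part /=; lia.
- move=> G Gr GD; apply: (bound _ (coords 1)) => [x y /set_mem/Gr xr /set_mem/Gr yr|x y Gx Gy].
    by move=> /(congr1 row4); rewrite !coordsK4.
  exact: dist_A_close (Gr _ Gx) (Gr _ Gy) (GD _ _ Gx Gy).
- exists [set z | z \in map row4 L]; split.
  + by move=> z /= /mapP[x _ ->]; exact: row4_root_lattice.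
  + move=> z w /= /mapP[x xL ->] /mapP[y yL ->]; move: xL yL.
    by rewrite !mL; exact: dist_A_le.
  + rewrite -sL -(size_map row4); apply: card_eq_seq => //.
    by rewrite (map_inj_uniq (can_inj row4K)).
Qed.
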